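(* Let $p\geq 1$ and let $\mathbb{H}_{2p+1}$ be the Heisenberg group, regarded as the $\mathbb{Z}_2^2$-symmetric space $\mathbb{H}_{2p+1}/H=\mathbb{H}_{2p+1}$ with $H=\{e\}$ defined by the $\mathbb{Z}_2^2$-grading $$\mathfrak{h}_{2p+1}=\{0\}\oplus \mathbb{R}\{X_{2p+1}\}\oplus\mathbb{R}\{X_1,X_3,\dots,X_{2p-1}\}\oplus\mathbb{R}\{X_2,X_4,\dots,X_{2p}\}.$$ Let $\nabla$ be a connection on $\mathbb{H}_{2p+1}$ adapted to this $\mathbb{Z}_2^2$-symmetric structure, given by the linear map $\Lambda:\mathfrak{h}_{2p+1}\to \mathfrak{gl}(\mathfrak{h}_{2p+1})$. Then the torsion $T$ and the curvature $R$ of $\nabla$ satisfy $T=0$ and $R=0$ if and only if $\Lambda$ satisfies, for some real constants $C_s^{2k+1}$ ($s=1,\dots,p$, $k=0,\dots,p-1$), $$\begin{cases}\Lambda(X_{2k+1})(X_{2s})=C_s^{2k+1}X_{2p+1}, & s=1,\dots,p,\ k=0,\dots,p-1,\\ \Lambda(X_{2k+1})(X_i)=0, & k=0,\dots,p-1,\ i\notin\{2,4,\dots,2p\},\end{cases}$$ $$\begin{cases}\Lambda(X_{2s})(X_{2k+1})=C_s^{2k+1}X_{2p+1}, & s=1,\dots,p,\ k=0,\dots,p-1,\ k\neq s-1,\\ \Lambda(X_{2s})(X_{2s-1})=(C_s^{2s-1}-1)X_{2p+1}, & s=1,\dots,p,\\ \Lambda(X_{2s})(X_i)=0, & s=1,\dots,p,\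 i\notin\{1,3,\dots,2p-1\}.\end{cases}$$
   Context: $\mathfrak{h}_{2p+1}$ is the Lie algebra of $\mathbb{H}_{2p+1}$, the real Heisenberg group of dimension $2p+1$; it has a basis $\{X_1,\dots,X_{2p+1}\}$ whose non-zero brackets are given by $[X_1,X_2]=[X_3,X_4]=\cdots=[X_{2p-1},X_{2p}]=X_{2p+1}$. Write the grading as $\mathfrak{h}_{2p+1}=\bigoplus_{\gamma\in\mathbb{Z}_2^2}\mathfrak{g}_\gamma$, with $\epsilon$ the unit of $\mathbb{Z}_2^2$ and $\mathfrak{g}_\epsilon=\{0\}$; since $H=\{e\}$, the reductive complement is $\mathfrak{m}=\mathfrak{h}_{2p+1}$. An (invariant) affine connection on $\mathbb{H}_{2p+1}$ is given by a linear map $\Lambda:\mathfrak{h}_{2p+1}\to\mathfrak{gl}(\mathfrak{h}_{2p+1})$; its torsion and curvature are $$T(X,Y)=\Lambda(X)(Y)-\Lambda(Y)(X)-[X,Y],\qquad R(X,Y)=[\Lambda(X),\Lambda(Y)]-\Lambda([X,Y]).$$ The connection is called adapted to the $\mathbb{Z}_2^2$-symmetric structure if $\Lambda(X_\gamma)(\mathfrak{g}_{\gamma'})\subset\mathfrak{g}_{\gamma\gamma'}$ for all $\gamma,\gamma'\neq\epsilon$ in $\mathbb{Z}_2^2$ and all $X_\gamma\in\mathfrak{g}_\gamma$.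
   Formalization: The displayed systems leave Λ(X_{2p+1}) unspecified, which makes the ''if'' direction false (p = 1, Λ(X_3)(X_1) = X_2 gives T ≠ 0); the formal statement adds the condition Λ(X_{2p+1}) = 0 to the systems. *)

(* Defs.v *)
(* Libraries: Mathematical Components, with the reals of MathComp-Analysis. *)
From HB Require Import structures.
From mathcomp Require Import all_boot all_order all_algebra.
From mathcomp Require Import reals.

Set Implicit Arguments.
Unset Strict Implicit.
Unset Printing Implicit Defensive.

Import Order.TTheory GRing.Theory Num.Theory.
Local Open Scope ring_scope.

Section Connection.
Variables (R : realType) (V : vectType R) (br : V -> V -> V).
Variable Lambda : {linear V -> 'End(V)}.

Definition gl_bracket (f g : 'End(V)) : 'End(V) := (f \o g)%VF - (g \o f)%VF.

(* An invariant connection on the Lie group with Lie algebra (V, br) is      *)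
(* identified with the linear map Lambda : V -> gl(V).                       *)
Definition torsion (X Y : V) : V := Lambda X Y - Lambda Y X - br X Y.

Definition curvature (X Y : V) : 'End(V) :=
  gl_bracket (Lambda X) (Lambda Y) - Lambda (br X Y).

(* The group Z_2^2 is written additively: its unit epsilon is 0, and the     *)
(* product of gamma and gamma' is gamma + gamma'.                            *)
Definition adapted (g : 'Z_2 * 'Z_2 -> {vspace V}) : Prop :=
  forall gamma gamma' : 'Z_2 * 'Z_2, gamma != 0 -> gamma' != 0 ->
  forall X : V, X \in g gamma ->
  forall Y : V, Y \in g gamma' -> Lambda X Y \in g (gamma + gamma').

End Connection.

Notation heis R p := 'rV[R]_(p.*2.+1).

Section Heisenberg.
Variables (R : realType) (p : nat).

(* The basis is numbered from 1 to 2p+1, so X_i is the (i-1)-st unit row     *)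
(* vector; heisX i = 0 when i is outside this range.                         *)
Definition heisX (i : nat) : heis R p := \row_(j < p.*2.+1) (j.+1 == i)%:R.

(* Coordinates are numbered from 0: X_(2k+1) and X_(2k+2) correspond to the  *)
(* coordinates 2k and 2k+1.                                                  *)
Definition heis_bracket (u v : heis R p) : heis R p :=
  (\sum_(k < p) (u 0 (inord k.*2) * v 0 (inord k.*2.+1) -
                 u 0 (inord k.*2.+1) * v 0 (inord k.*2))) *: heisX p.*2.+1.

Definition heis_grading (gamma : 'Z_2 * 'Z_2) : {vspace heis R p} :=
  if gamma == (0, 0) then 0%VS
  else if gamma == (0, 1) then <[heisX p.*2.+1]>%VS
  else if gamma == (1, 0) then <<[seq heisX k.*2.+1 | k <- iota 0 p]>>%VS
  else <<[seq heisX s.*2 | s <- iota 1 p]>>%VS.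

Lemma heisX_coord i m : (m < p.*2.+1)%N ->
  heisX i 0 (inord m) = (m.+1 == i)%:R.
Proof. by move=> lt_m; rewrite mxE inordK. Qed.

Lemma heis_bracketX k : (k < p)%N ->
  heis_bracket (heisX k.*2.+1) (heisX k.*2.+2) = heisX p.*2.+1.
Proof.
move=> lt_kp; rewrite /heis_bracket (bigD1 (Ordinal lt_kp)) //= big1 => [|l].
  have h : (k.*2.+1 < p.*2.+1)%N by rewrite ltnS ltn_double.
  rewrite !heisX_coord ?(ltnW h) // !eqxx !eqSS.
  by rewrite -[_ == k.*2]negbK neq_ltn ltnSn orbT mul0r subr0 mul1r addr0 scale1r.
rewrite -val_eqE /= => /negPf ne_lk.
have h : (l.*2.+1 < p.*2.+1)%N by rewrite ltnS ltn_double.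
rewrite !heisX_coord ?(ltnW h) // !eqSS.
have -> : (l.*2 == k.*2) = false by rewrite (inj_eq double_inj).
have -> : (l.*2.+1 == k.*2) = false.
  by apply/eqP => /(congr1 odd); rewrite /= !odd_double.
by rewrite !mul0r subr0.
Qed.

Lemma heis_bracketC u v : heis_bracket u v = - heis_bracket v u.
Proof.
rewrite /heis_bracket -scaleNr -sumrN; congr (_ *: _).
by apply: eq_bigr => k _; rewrite opprB ![v _ _ * _]mulrC.
Qed.

Lemma heis_bracketX0 i j :
  (forall k, (k < p)%N -> (i, j) <> (k.*2.+1, k.*2.+2)) ->
  (forall k, (k < p)%N -> (j, i) <> (k.*2.+1, k.*2.+2)) ->
  heis_bracket (heisX i) (heisX j) = 0.
Proof.
move=> nij nji; rewrite /heis_bracket big1 ?scale0r // => k _.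
have h : (k.*2.+1 < p.*2.+1)%N by rewrite ltnS ltn_double.
rewrite !heisX_coord ?(ltnW h) // -!natrM !mulnb.
have /negbTE -> : ~~ ((k.*2.+1 == i) && (k.*2.+2 == j)).
  by apply/andP => -[/eqP ei /eqP ej]; apply: (nij k) => //; rewrite -ei -ej.
have /negbTE -> : ~~ ((k.*2.+2 == i) && (k.*2.+1 == j)).
  by apply/andP => -[/eqP ei /eqP ej]; apply: (nji k) => //; rewrite -ei -ej.
by rewrite subrr.
Qed.

End Heisenberg.

(* Main.v *)
Require Import Defs.
From HB Require Import structures.
From mathcomp Require Import all_boot all_order all_algebra.
From mathcomp Require Import reals.
From mathcomp Require Import zify.

Set Implicit Arguments.
Unset Strict Implicit.
Unset Printing Implicit Defensive.

Import Order.TTheory GRing.Theory Num.Theory.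
Local Open Scope ring_scope.

(** Write U, W and Z for the span of the X_(2k+1), the span of the X_(2s) and the
    central vector X_(2p+1), and omega for the form with [x, y] = omega(x, y) Z.

    The heart of the matter is that a flat torsion-free adapted connection has
    Lambda(Z) = 0.  The grading gives Lambda(Z) Z = 0, Lambda(Z) U in W,
    Lambda(Z) W in U, and Lambda(U) U = Lambda(W) W = 0.  For u in U, combining
    the vanishing of T and R on the vectors of U, on Z and on c = Lambda(Z) u
    shows that omega(u', c) = 0 for all u' in U, hence c = 0 because omega puts
    U and W in duality.  The argument is [flat_central_operator_eq0], stated for
    an abstract pair of subspaces so that the same lemma, with U and W exchanged,
    kills Lambda(Z) on W ([adapted_flat_LambdaZ]).

    Once Lambda(Z) = 0, the torsion equation with Z central gives
    Lambda(x) Z = 0 for all x.  The grading puts Lambda(X_(2k+1)) X_(2s) on the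
    line of Z, which defines the constants C, and the torsion equation between
    X_(2k+1) and X_(2s) then yields Lambda(X_(2s)) X_(2k+1), the correction -1
    being the bracket [X_(2s-1), X_(2s)] = Z.

    Conversely, for Lambda of the prescribed form each of the three terms of
    the curvature vanishes, since Lambda takes values in the line of Z, which
    every Lambda(x) kills, and Lambda(Z) = 0 ([two_step_flat]).  The torsion
    vanishes on pairs of basis vectors by inspection, hence everywhere
    ([heis_torsion_eq0]). *)

(** * Invariant connections on a Lie group *)

Section InvariantConnection.
Variables (R : realType) (V : vectType R) (br : V -> V -> V).
Variable Lambda : {linear V -> 'End(V)}.

Lemma curvatureE X Y v :
  curvature br Lambda X Y v
    = Lambda X (Lambda Y v) - Lambda Y (Lambda X v) - Lambda (br X Y) v.
Proof. by rewrite /curvature /gl_bracket !(add_lfunE, opp_lfunE, comp_lfunE). Qed.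

Lemma torsionC X Y : (forall u v, br u v = - br v u) ->
  torsion br Lambda X Y = - torsion br Lambda Y X.
Proof. by move=> brC; rewrite /torsion brC !opprD !opprK [X in X + _]addrC. Qed.

Lemma torsion_linearl Y : (forall Z, linear (br^~ Z)) ->
  linear (fun X => torsion br Lambda X Y).
Proof.
move=> br_lin a u v; rewrite /torsion br_lin !linearP add_lfunE scale_lfunE.
by rewrite !scalerDr [RHS]addrACA; congr (_ + _); rewrite addrACA.
Qed.

(** The vector c = Lambda(z) u of W is shown to be orthogonal to U for the
    pairing defined by [u', w] = omega(u', w) z.  The equation R(u', z) u = 0
    reads Lambda(u') c = 0, so the torsion equation gives
    Lambda(c) u' = - [u', c].  Then R(u, c) u' = 0 becomes
    omega(u', c) c + omega(u, c) Lambda(z) u' = 0.  Taking u' = u yields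
    2 omega(u, c) c = 0, so that omega(u, c) = 0 unless c = 0, after which the
    same equation yields omega(u', c) c = 0 for all u'. *)
Lemma flat_central_operator_eq0 (z : V) (U W : {vspace V}) :
    (forall u, u \in U -> br u z = 0) ->
    (forall u w, u \in U -> w \in W -> br u w \in <[z]>%VS) ->
    (forall w, w \in W -> (forall u, u \in U -> br u w = 0) -> w = 0) ->
    (forall u u', u \in U -> u' \in U -> Lambda u u' = 0) ->
    (forall u, u \in U -> Lambda z u \in W) ->
    (forall X Y, torsion br Lambda X Y = 0) ->
    (forall X Y, curvature br Lambda X Y = 0) ->
  forall u, u \in U -> Lambda z u = 0.
Proof.
move=> brUz brUW nondeg LUU LzU T0 R0 u uU.
have Rv X Y v : Lambda X (Lambda Y v) - Lambda Y (Lambda X v)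
                - Lambda (br X Y) v = 0 by rewrite -curvatureE R0 lfunE.
set c := Lambda z u; have cW : c \in W by apply: LzU.
have Lc u' : u' \in U -> Lambda u' c = 0.
  move=> u'U; have := Rv u' z u.
  by rewrite (LUU u' u) // brUz // !linear0 zero_lfunE subr0 addr0.
have cL u' : u' \in U -> Lambda c u' = - br u' c.
  move=> u'U; have /eqP := T0 u' c.
  by rewrite /torsion Lc // sub0r subr_eq0 => /eqP <-; rewrite opprK.
have Luz : Lambda u z = c.
  have /eqP := T0 u z.
  by rewrite /torsion brUz // subr0 subr_eq0 => /eqP.
have main u' a a' : u' \in U -> br u c = a *: z -> br u' c = a' *: z ->
    a' *: c + a *: Lambda z u' = 0.
  move=> u'U eqa eqa'; have := Rv u c u'.
  rewrite (LUU u u') // [Lambda c 0]raddf0 subr0 cL // eqa eqa' -scaleNr.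
  rewrite [Lambda (a *: z)]linearZ scale_lfunE [Lambda u _]linearZ /= Luz.
  by rewrite scaleNr -opprD => /eqP; rewrite oppr_eq0 => /eqP.
have [//|c_neq0] := eqVneq c 0; apply: nondeg => // u' u'U.
have /vlineP [a eqa] := brUW _ _ uU cW.
have a0 : a = 0.
  have /eqP := main u a a uU eqa eqa.
  rewrite -scalerDl scaler_eq0 (negPf c_neq0) orbF -mulr2n mulrn_eq0 /=.
  by move/eqP.
have /vlineP [a' eqa'] := brUW _ _ u'U cW.
have /eqP := main u' a a' u'U eqa eqa'.
rewrite a0 scale0r addr0 scaler_eq0 (negPf c_neq0) orbF => /eqP a'0.
by rewrite eqa' a'0 scale0r.
Qed.

End InvariantConnection.

(** * The Heisenberg algebra and its grading *)

Section HeisenbergAlgebra.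
Variables (R : realType) (p : nat).
Local Notation V := (heis R p).
Local Notation X := (heisX R p).
Local Notation Z := (heisX R p p.*2.+1).
Local Notation br := (@heis_bracket R p).

(** To be applied to predicates stating that two linear maps agree at v, or
    that a linear map sends v into a given subspace. *)
Lemma heis_ind (P : V -> Prop) :
    (forall a u v, P u -> P v -> P (a *: u + v)) ->
    (forall k, (k < p)%N -> P (X k.*2.+1)) ->
    (forall k, (k < p)%N -> P (X k.*2.+2)) -> P Z ->
  forall v, P v.
Proof.
move=> Plin Podd Peven PZ v.
have P0 : P 0 by rewrite -(addNr Z) -scaleN1r; apply: Plin.
have PX (j : 'I_p.*2.+1) : P (X j.+1).
  have := odd_double_half j; have := ltn_ord j.
  case: (odd j) => /= ltj eqj; rewrite -eqj; last first.
    by have [lt|ge] := ltnP j./2 p; [apply: Podd | have -> : j./2 = p by lia].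
  by apply: Peven; lia.
have -> : v = \sum_j v 0 j *: X j.+1.
  rewrite {1}[v]row_sum_delta; apply: eq_bigr => j _; congr (_ *: _).
  by apply/rowP => i; rewrite !mxE eqxx /= eqSS.
apply: (big_ind P) => [//|x y Px Py|j _].
  by rewrite -[x]scale1r; apply: Plin.
by rewrite -[_ *: _]addr0; apply: Plin.
Qed.

Lemma heis_bracket_linearl v : linear (br^~ v).
Proof.
move=> a u u'; rewrite /heis_bracket scalerA -scalerDl; congr (_ *: _).
rewrite mulr_sumr -big_split /=; apply: eq_bigr => k _; rewrite !mxE.
by rewrite mulrBr !mulrDl !mulrA opprD addrACA.
Qed.

Lemma heis_bracketZr u : br u Z = 0.
Proof.
rewrite /heis_bracket big1 ?scale0r // => k _; have ltk := ltn_ord k.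
rewrite !heisX_coord; [|lia..].
by rewrite !eqSS !ltn_eqF ?mulr0 ?subr0 //; lia.
Qed.

Lemma heis_bracketXodd k v : (k < p)%N ->
  br (X k.*2.+1) v = v 0 (inord k.*2.+1) *: Z.
Proof.
move=> lt_kp; rewrite /heis_bracket (bigD1 (Ordinal lt_kp)) //= big1 => [|l ne].
  rewrite !heisX_coord; [|lia..]; rewrite eqxx (_ : _ == _ = false); last lia.
  by rewrite mul1r mul0r subr0 addr0.
have ltl := ltn_ord l; have {}ne : (l : nat) != k by [].
rewrite !heisX_coord; [|lia..].
rewrite (_ : _.+1 == _ = false) 1?(_ : _.+2 == _ = false); [|lia..].
by rewrite !mul0r subr0.
Qed.

Lemma heis_bracketXeven k v : (k < p)%N ->
  br (X k.*2.+2) v = - v 0 (inord k.*2) *: Z.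
Proof.
move=> lt_kp; rewrite /heis_bracket (bigD1 (Ordinal lt_kp)) //= big1 => [|l ne].
  rewrite !heisX_coord; [|lia..]; rewrite eqxx (_ : _ == _ = false); last lia.
  by rewrite mul1r mul0r sub0r addr0.
have ltl := ltn_ord l; have {}ne : (l : nat) != k by [].
rewrite !heisX_coord; [|lia..].
rewrite (_ : _.+1 == _ = false) 1?(_ : _.+2 == _ = false); [|lia..].
by rewrite !mul0r subr0.
Qed.

(** In the grading, g_(1,0) is spanned by the X_(2k+1) and g_(1,1) by the
    X_(2s).  Both are isotropic for the symplectic form that defines the bracket,
    and that form puts them in duality.  The local names U and W stand for the
    two components. *)
Local Notation U := (@heis_grading R p (1, 0)).
Local Notation W := (@heis_grading R p (1, 1)).

Lemma span_coord0 (S : seq V) j w :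
  (forall v, v \in S -> v 0 j = 0) -> w \in <<S>>%VS -> w 0 j = 0.
Proof.
move=> S0 /(@coord_span _ _ _ (in_tuple S)) ->; rewrite summxE big1 // => i _.
by rewrite mxE S0 ?mulr0 // mem_nth.
Qed.

Lemma heis_coordP (w : V) :
    (forall k, (k < p)%N -> w 0 (inord k.*2) = 0) ->
    (forall k, (k < p)%N -> w 0 (inord k.*2.+1) = 0) ->
  w 0 (inord p.*2) = 0 -> w = 0.
Proof.
move=> w_even w_odd w_max; apply/rowP => j; rewrite mxE -[j]inord_val.
have := odd_double_half j; have := ltn_ord j.
case: (odd j) => /= ltj eqj; rewrite -eqj; last first.
  by have [lt|ge] := ltnP j./2 p; [apply: w_even | have -> : j./2 = p by lia].
by apply: w_odd; lia.
Qed.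

Lemma mem_gradingZ : Z \in @heis_grading R p (0, 1).
Proof. by rewrite /heis_grading /= memv_line. Qed.

Lemma mem_gradingXodd k : (k < p)%N -> X k.*2.+1 \in U.
Proof.
move=> ltk; rewrite /heis_grading /=; apply: memv_span.
by apply: (map_f (fun k => X k.*2.+1)); rewrite mem_iota.
Qed.

Lemma mem_gradingXeven k : (k < p)%N -> X k.*2.+2 \in W.
Proof.
move=> ltk; rewrite /heis_grading /= -doubleS; apply: memv_span.
by apply: (map_f (fun k => X k.*2)); rewrite mem_iota; lia.
Qed.

Lemma gradingU_coord0 w m : w \in U -> (m < p.*2.+1)%N ->
  odd m || (m == p.*2) -> w 0 (inord m) = 0.
Proof.
rewrite /heis_grading /= => wU ltm m_odd; apply: span_coord0 wU => v.
case/mapP=> k; rewrite mem_iota => ltk ->.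
by rewrite heisX_coord //; case: eqP => //; lia.
Qed.

Lemma gradingW_coord0 w m : w \in W -> (m < p.*2.+1)%N ->
  ~~ odd m -> w 0 (inord m) = 0.
Proof.
rewrite /heis_grading /= => wW ltm m_even; apply: span_coord0 wW => v.
case/mapP=> k; rewrite mem_iota => ltk ->.
by rewrite heisX_coord //; case: eqP => //; lia.
Qed.

Lemma heis_nondegW w : w \in W -> (forall u, u \in U -> br u w = 0) -> w = 0.
Proof.
move=> wW orth; apply: heis_coordP => [k ltk|k ltk|].
- by apply: gradingW_coord0 => //; lia.
- have /eqP := orth _ (mem_gradingXodd ltk).
  rewrite heis_bracketXodd // scaler_eq0 => /orP [/eqP //|/eqP/rowP/(_ (inord p.*2))].
  by rewrite heisX_coord // eqxx mxE => /eqP; rewrite oner_eq0.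
- by apply: gradingW_coord0 => //; lia.
Qed.

Lemma heis_nondegU u : u \in U -> (forall w, w \in W -> br w u = 0) -> u = 0.
Proof.
move=> uU orth; apply: heis_coordP => [k ltk|k ltk|].
- have /eqP := orth _ (mem_gradingXeven ltk).
  rewrite heis_bracketXeven // scaler_eq0 oppr_eq0.
  case/orP => [/eqP //|/eqP/rowP/(_ (inord p.*2))].
  by rewrite heisX_coord // eqxx mxE => /eqP; rewrite oner_eq0.
- by apply: gradingU_coord0 => //; lia.
- by apply: gradingU_coord0 => //; lia.
Qed.

Lemma heis_bracket_line u v : br u v \in <[Z]>%VS.
Proof. by rewrite memvZ ?memv_line. Qed.

(** * Adapted connections on the Heisenberg group *)

Variable Lambda : {linear V -> 'End(V)}.

Section Adapted.
Hypothesis Lambda_adapted : adapted Lambda (@heis_grading R p).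

Lemma adapted_UU u u' : u \in U -> u' \in U -> Lambda u u' = 0.
Proof.
move=> uU u'U; have := @Lambda_adapted (1, 0) (1, 0) isT isT _ uU _ u'U.
by rewrite /heis_grading /= memv0 => /eqP.
Qed.

Lemma adapted_WW w w' : w \in W -> w' \in W -> Lambda w w' = 0.
Proof.
move=> wW w'W; have := @Lambda_adapted (1, 1) (1, 1) isT isT _ wW _ w'W.
by rewrite /heis_grading /= memv0 => /eqP.
Qed.

Lemma adapted_ZZ : Lambda Z Z = 0.
Proof.
have := @Lambda_adapted (0, 1) (0, 1) isT isT _ mem_gradingZ _ mem_gradingZ.
by rewrite /heis_grading /= memv0 => /eqP.
Qed.

Lemma adapted_ZU u : u \in U -> Lambda Z u \in W.
Proof.
exact: (@Lambda_adapted (0, 1) (1, 0) isT isT _ mem_gradingZ _).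
Qed.

Lemma adapted_ZW w : w \in W -> Lambda Z w \in U.
Proof.
exact: (@Lambda_adapted (0, 1) (1, 1) isT isT _ mem_gradingZ _).
Qed.

Lemma adapted_UW u w : u \in U -> w \in W -> Lambda u w \in <[Z]>%VS.
Proof.
by move=> uU; apply: (@Lambda_adapted (1, 0) (1, 1) isT isT _ uU).
Qed.

Hypothesis T0 : forall u v, torsion br Lambda u v = 0.
Hypothesis R0 : forall u v, curvature br Lambda u v = 0.

(** The roles of U and W are interchangeable in the general lemma, because the
    bracket puts the two in duality; on the remaining line, Lambda(Z) Z lies in
    g_0 = 0. *)
Lemma adapted_flat_LambdaZ : Lambda Z = 0.
Proof.
have LZU : forall u, u \in U -> Lambda Z u = 0.
  apply: (flat_central_operator_eq0 (W := W)) T0 R0 => // [u _||||].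
  - exact: heis_bracketZr.
  - by move=> *; apply: heis_bracket_line.
  - exact: heis_nondegW.
  - exact: adapted_UU.
  - exact: adapted_ZU.
have LZW : forall w, w \in W -> Lambda Z w = 0.
  apply: (flat_central_operator_eq0 (W := U)) T0 R0 => // [u _||||].
  - exact: heis_bracketZr.
  - by move=> *; apply: heis_bracket_line.
  - exact: heis_nondegU.
  - exact: adapted_WW.
  - exact: adapted_ZW.
apply/lfunP => v; rewrite zero_lfunE; move: v.
apply: heis_ind => [a u v u0 v0|k ltk|k ltk|].
- by rewrite linearP /= u0 v0 scaler0 addr0.
- by rewrite LZU ?mem_gradingXodd.
- by rewrite LZW ?mem_gradingXeven.
- exact: adapted_ZZ.
Qed.

Lemma adapted_flat_Lambda_r u : Lambda u Z = 0.
Proof.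
have /eqP := T0 u Z; rewrite /torsion heis_bracketZr adapted_flat_LambdaZ.
by rewrite zero_lfunE !subr0 => /eqP.
Qed.

End Adapted.

(** All three terms of the curvature vanish separately: Lambda takes its values
    in the line of Z, which every Lambda(u) kills, and every bracket is a
    multiple of Z, which Lambda kills. *)
Lemma two_step_flat :
    (forall u v, Lambda u v \in <[Z]>%VS) -> (forall u, Lambda u Z = 0) ->
    Lambda Z = 0 ->
  forall u v, curvature br Lambda u v = 0.
Proof.
move=> Lline LrZ LZ u v; apply/lfunP => w; rewrite curvatureE zero_lfunE.
have LL u' v' w' : Lambda u' (Lambda v' w') = 0.
  by have /vlineP[a ->] := Lline v' w'; rewrite linearZ /= LrZ scaler0.
have /vlineP[a ->] := heis_bracket_line u v.
by rewrite !LL linearZ /= LZ scaler0 zero_lfunE !subr0.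
Qed.

(** The torsion is bilinear and skew-symmetric, so it is enough to test it on
    pairs of basis vectors, in one order only. *)
Lemma heis_torsion_eq0 :
    (forall k l, (k < p)%N -> (l < p)%N ->
       torsion br Lambda (X k.*2.+1) (X l.*2.+1) = 0) ->
    (forall k l, (k < p)%N -> (l < p)%N ->
       torsion br Lambda (X k.*2.+1) (X l.*2.+2) = 0) ->
    (forall k l, (k < p)%N -> (l < p)%N ->
       torsion br Lambda (X k.*2.+2) (X l.*2.+2) = 0) ->
    (forall u, torsion br Lambda u Z = 0) ->
  forall u v, torsion br Lambda u v = 0.
Proof.
set T := torsion br Lambda => TUU TUW TWW TZ.
have TC u v : T u v = 0 -> T v u = 0.
  by move=> Tuv; rewrite /T torsionC ?[torsion _ _ _ _]Tuv ?oppr0 //;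
     apply: heis_bracketC.
have Tl v : (forall k, (k < p)%N -> T (X k.*2.+1) v = 0) ->
            (forall k, (k < p)%N -> T (X k.*2.+2) v = 0) ->
    forall u, T u v = 0.
  move=> TU TW; apply: heis_ind => // [a u w u0 w0|]; last exact: TC.
  rewrite /T torsion_linearl; last exact: heis_bracket_linearl.
  by rewrite -/T u0 w0 scaler0 addr0.
move=> u v; apply: (TC); move: v; apply: (Tl) => k ltk; apply: (TC); move: u;
  apply: (Tl) => l ltl.
- exact: TUU.
- by apply: TC; apply: TUW.
- exact: TUW.
- exact: TWW.
Qed.

End HeisenbergAlgebra.

Theorem theorem27 (R : realType) (p : nat) (p_ge1 : (1 <= p)%N)
    (Lambda : {linear heis R p -> 'End(heis R p)})
    (Lambda_adapted : adapted Lambda (@heis_grading R p)) :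
  ((forall X Y : heis R p, torsion (@heis_bracket R p) Lambda X Y = 0) /\
   (forall X Y : heis R p, curvature (@heis_bracket R p) Lambda X Y = 0))
  <->
  exists C : nat -> nat -> R,
    (forall s k : nat, (1 <= s <= p)%N -> (k < p)%N ->
       Lambda (heisX R p k.*2.+1) (heisX R p s.*2)
         = C s k.*2.+1 *: heisX R p p.*2.+1) /\
    (forall k i : nat, (k < p)%N -> (1 <= i <= p.*2.+1)%N ->
       i \notin [seq s.*2 | s <- iota 1 p] ->
       Lambda (heisX R p k.*2.+1) (heisX R p i) = 0) /\
    (forall s k : nat, (1 <= s <= p)%N -> (k < p)%N -> k <> s.-1 ->
       Lambda (heisX R p s.*2) (heisX R p k.*2.+1)
         = C s k.*2.+1 *: heisX R p p.*2.+1) /\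
    (forall s : nat, (1 <= s <= p)%N ->
       Lambda (heisX R p s.*2) (heisX R p s.*2.-1)
         = (C s s.*2.-1 - 1) *: heisX R p p.*2.+1) /\
    (forall s i : nat, (1 <= s <= p)%N -> (1 <= i <= p.*2.+1)%N ->
       i \notin [seq k.*2.+1 | k <- iota 0 p] ->
       Lambda (heisX R p s.*2) (heisX R p i) = 0) /\
    Lambda (heisX R p p.*2.+1) = 0.
Proof.
split=> [[T0 R0]|[C [Cuw [C0u [Cwu [Cwu1 [C0w LZ]]]]]]].
  have LZ := adapted_flat_LambdaZ Lambda_adapted T0 R0.
  have LrZ := adapted_flat_Lambda_r Lambda_adapted T0 R0.
  (* The constant C_s^m is the only coordinate that the grading allows
     Lambda(X_m)(X_(2s)) to have. *)
  pose C s m := Lambda (heisX R p m) (heisX R p s.*2) 0 (inord p.*2).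
  have LC s k : (1 <= s <= p)%N -> (k < p)%N ->
      Lambda (heisX R p k.*2.+1) (heisX R p s.*2)
        = C s k.*2.+1 *: heisX R p p.*2.+1.
    case: s => // s lts ltk.
    have /vlineP[a eqa] := adapted_UW Lambda_adapted
      (mem_gradingXodd R ltk) (mem_gradingXeven R lts).
    rewrite /C doubleS eqa !mxE inordK // eqxx mulr1 //.
  have LCr s k : (1 <= s <= p)%N -> (k < p)%N ->
      Lambda (heisX R p s.*2) (heisX R p k.*2.+1)
        = (C s k.*2.+1 - (k == s.-1)%:R) *: heisX R p p.*2.+1.
    case: s => // s lts ltk.
    have /eqP := T0 (heisX R p k.*2.+1) (heisX R p s.*2.+2).
    rewrite /torsion -doubleS LC // heis_bracketXodd // heisX_coord; last lia.
    rewrite addrAC subr_eq0 => /eqP <-; rewrite scalerBl.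
    by congr (_ - _%:R *: _); lia.
  exists C; do ![split] => //.
  - move=> k i ltk lti; rewrite -[i]odd_double_half.
    have := odd_double_half i; case: (odd i) => /= eqi ni.
      have [lt|ge] := ltnP i./2 p.
        by apply: (adapted_UU Lambda_adapted); apply: mem_gradingXodd.
      by rewrite (_ : i./2 = p) ?LrZ //; lia.
    by case/negP: ni; apply: map_f; rewrite mem_iota; lia.
  - move=> s k lts ltk /eqP/negPf nks.
    by rewrite LCr // nks subr0.
  - case=> // s lts; have := LCr s.+1 s lts lts.
    by rewrite eqxx doubleS.
  - case=> // s i lts lti; rewrite -[i]odd_double_half doubleS.
    have := odd_double_half i; case: (odd i) => /= eqi ni.
      have [lt|ge] := ltnP i./2 p.
        by case/negP: ni; apply: map_f; rewrite mem_iota.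
      by rewrite (_ : i./2 = p) ?LrZ //; lia.
    case: {ni} i./2 eqi lti => [|j] eqi lti; first by lia.
    apply: (adapted_WW Lambda_adapted); apply: mem_gradingXeven => //; lia.
pose X := heisX R p; pose Z := X p.*2.+1.
have LUW k l : (k < p)%N -> (l < p)%N ->
    Lambda (X k.*2.+1) (X l.*2.+2) = C l.+1 k.*2.+1 *: Z.
  by move=> ltk ltl; rewrite -doubleS Cuw.
(* For indices k, l < p, the two formulas for Lambda(X_(2s))(X_(2k+1)) merge
   into one. *)
have LWU k l : (k < p)%N -> (l < p)%N ->
    Lambda (X l.*2.+2) (X k.*2.+1) = (C l.+1 k.*2.+1 - (k == l)%:R) *: Z.
  move=> ltk ltl; rewrite -doubleS; case: eqVneq => [->|/eqP ne].
    by have := Cwu1 l.+1; rewrite doubleS /= => ->.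
  by rewrite subr0 Cwu.
have LUU k l : (k < p)%N -> (l < p)%N -> Lambda (X k.*2.+1) (X l.*2.+1) = 0.
  move=> ltk ltl; apply: C0u => //; first by lia.
  by apply/mapP => -[s _]; lia.
have LWW k l : (k < p)%N -> (l < p)%N -> Lambda (X k.*2.+2) (X l.*2.+2) = 0.
  move=> ltk ltl; rewrite -[k.*2.+2]doubleS; apply: C0w => //; first by lia.
  by apply/mapP => -[s _]; lia.
have LUZ k : (k < p)%N -> Lambda (X k.*2.+1) Z = 0.
  by move=> ltk; apply: C0u; [lia..|]; apply/mapP => -[s _]; lia.
have LWZ k : (k < p)%N -> Lambda (X k.*2.+2) Z = 0.
  move=> ltk; rewrite -doubleS; apply: C0w; [lia..|].
  by apply/mapP => -[s]; rewrite mem_iota; lia.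
have LrZ : forall u, Lambda u Z = 0.
  apply: heis_ind => // [a u v u0 v0|]; last by rewrite LZ zero_lfunE.
  by rewrite linearP add_lfunE scale_lfunE u0 v0 scaler0 addr0.
split; last first.
  apply: two_step_flat => // u v; move: v u.
  apply: heis_ind => [a u v u0 v0 w|k ltk|k ltk|u].
  - by rewrite linearP /= rpredD ?rpredZ.
  - apply: heis_ind => [a u v u0 v0|l ltl|l ltl|].
    + by rewrite linearP add_lfunE scale_lfunE rpredD ?rpredZ.
    + by rewrite LUU ?rpred0.
    + by rewrite LWU // rpredZ ?memv_line.
    + by rewrite LZ zero_lfunE rpred0.
  - apply: heis_ind => [a u v u0 v0|l ltl|l ltl|].
    + by rewrite linearP add_lfunE scale_lfunE rpredD ?rpredZ.
    + by rewrite LUW // rpredZ ?memv_line.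
    + by rewrite LWW ?rpred0.
    + by rewrite LZ zero_lfunE rpred0.
  - by rewrite LrZ rpred0.
apply: heis_torsion_eq0 => [k l ltk ltl|k l ltk ltl|k l ltk ltl|u].
- by rewrite /torsion !LUU // heis_bracketX0 ?subr0 // => m _ [] *; lia.
- rewrite /torsion LUW // LWU // heis_bracketXodd // heisX_coord; last by lia.
  by rewrite !eqSS (inj_eq double_inj) -!scalerBl subKr subrr scale0r.
- by rewrite /torsion !LWW // heis_bracketX0 ?subr0 // => m _ [] *; lia.
- by rewrite /torsion LrZ LZ zero_lfunE heis_bracketZr !subr0.
Qed.
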